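(* There exists $N$ such that for every integer $n\geq N$ there exists a simple graph $G$ on $n$ vertices with $\mathcal{E}(G)\geq n^{3/2}/2-n^{11/10}$.
   Context: For a complex $m\times n$ matrix $A$ with singular values $\sigma_1(A)\geq\sigma_2(A)\geq\cdots$ (the square roots of the eigenvalues of $AA^{\ast}$), the energy of $A$ is $\mathcal{E}(A)=\sigma_1(A)+\sigma_2(A)+\cdots$. For a graph $G$, $\mathcal{E}(G)=\mathcal{E}(A(G))$ where $A(G)$ is the adjacency matrix of $G$; equivalently, the sum of the absolute values of the eigenvalues of $A(G)$. *)

(* Defs.v *)
From HB Require Import structures.
From mathcomp Require Import all_boot all_order all_algebra.
From mathcomp Require Import complex.
From mathcomp Require Import all_classical all_reals all_analysis.

Set Implicit Arguments.
Unset Strict Implicit.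
Unset Printing Implicit Defensive.

Import Order.TTheory GRing.Theory Num.Theory.

Local Open Scope ring_scope.
Local Open Scope complex_scope.

(* The roots of the characteristic polynomial, with algebraic multiplicity,
   in an unspecified order (see eigenvaluesP). *)
Definition eigenvalues (C : closedFieldType) (n : nat) (A : 'M[C]_n) : seq C :=
  sval (closed_field_poly_normal (char_poly A)).

Lemma eigenvaluesP (C : closedFieldType) (n : nat) (A : 'M[C]_n) :
  char_poly A = \prod_(z <- eigenvalues A) ('X - z%:P).
Proof.
rewrite /eigenvalues; case: closed_field_poly_normal => s /= {1}->.
by rewrite (monicP (char_poly_monic A)) scale1r.
Qed.

Definition adjointmx (R : rcfType) (m n : nat) (A : 'M[R[i]]_(m, n)) :
    'M[R[i]]_(n, m) :=
  map_mx (@conjc R) A^T.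

(* The eigenvalues of A A^* are real and nonnegative, so complex.Re only
   transports them from R[i] to R. *)
Definition singular_values (R : rcfType) (m n : nat) (A : 'M[R[i]]_(m, n)) :
    seq R :=
  sort >=%R [seq Num.sqrt (complex.Re z) | z <- eigenvalues (A *m adjointmx A)].

Definition energy (R : rcfType) (m n : nat) (A : 'M[R[i]]_(m, n)) : R :=
  \sum_(s <- singular_values A) s.

Record simple_graph (T : finType) := SimpleGraph {
  adj :> rel T;
  adj_sym : symmetric adj;
  adj_irr : irreflexive adj }.

Definition adjacency_mx (R : rcfType) (n : nat) (G : simple_graph 'I_n) :
    'M[R[i]]_n :=
  \matrix_(i, j) (G i j)%:R.

Definition graph_energy (R : rcfType) (n : nat) (G : simple_graph 'I_n) : R :=
  energy (adjacency_mx R G).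

(* Main.v *)
Require Import Defs.
From HB Require Import structures.
From mathcomp Require Import all_boot all_order all_algebra.
From mathcomp Require Import spectral sesquilinear.
From mathcomp Require Import complex ring lra zify.
From mathcomp Require Import all_classical all_reals all_analysis.

Set Implicit Arguments.
Unset Strict Implicit.
Unset Printing Implicit Defensive.

Import Order.TTheory GRing.Theory Num.Theory.
Local Open Scope ring_scope.

(** If [S] is a symmetric Hadamard matrix of order [N ^ 2], then pairing the
    graph "[S x y = -1]" with the orthogonal matrix [- S / N] shows that its
    energy is at least [(N ^ 3 - N ^ 2) / 2 - N]; isolated vertices are free.
    A Hadamard matrix [A] of order [N] gives such an [S], namely
    [S (i, j) (k, l) = A i l * A k j].  So it suffices to find, for every large
    [n], a Hadamard order [N] with [sqrt n - N] smaller than [n ^ (1 / 10)].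

    Such orders are obtained without primes, in the style of Craigen and
    de Launey: [N = (1 + 4 (l_1 + ... + l_r)) 4 ^ (r + 1)] is a Hadamard order
    whenever each [l_i] is the length [2 ^ a 10 ^ b] of a Golay pair.  The
    symmetrised Golay sequences are laid out side by side on the cyclic group
    of order [1 + 4 (l_1 + ... + l_r)] and multiplied by anticommuting signed
    permutation matrices of size [O(4 ^ r)], which kills all the cross terms.
    The numbers [2 ^ a 10 ^ b] have relative gaps below [1 / 512], so a greedy
    choice of [l_1, ..., l_r] reaches any target up to [512 ^ r] within a
    bounded error, which makes [sqrt n - N = O(4 ^ r) = O(n ^ (1 / 11))]. *)

(** * Signed permutation matrices over a group *)

Section Clifford.
Variables (R : realFieldType) (G : finZmodType).

Definition signmx m n (A : 'M[R]_(m, n)) := forall i j, A i j ^+ 2 = 1.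

(** Stands in for [A] being a signed permutation matrix; the Hadamard construction uses it in this
    form. *)
Definition preserves_signs h (A : 'M[R]_h) :=
  forall k (F : 'M[R]_(h, k)), signmx F -> signmx (A *m F).

Definition autocor (f : G -> R) s := \sum_x f x * f (x + s).

Definition has_autocor h (C : G -> 'M[R]_h) (kappa : G -> R) :=
  forall s, \sum_x C x *m (C (x + s))^T = (kappa s)%:M.

(* [X], [Y] and [C] are the coefficients of three anticommuting 2 x 2 signed
   permutation matrices. *)
Definition clifford_step h (C : G -> 'M[R]_h) (X Y : G -> R) x : 'M[R]_(h + h) :=
  block_mx (X x)%:M (C x + (Y x)%:M) (C x - (Y x)%:M) (- (X x)%:M).

Lemma clifford_step_tr h (C : G -> 'M[R]_h) X Y :
    (forall x, C (- x) = (C x)^T) -> (forall x, X (- x) = X x) ->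
    (forall x, Y (- x) = - Y x) ->
  forall x, clifford_step C X Y (- x) = (clifford_step C X Y x)^T.
Proof.
move=> CN XN YN x; rewrite /clifford_step tr_block_mx CN XN YN.
by rewrite !linearD !linearN /= !tr_scalar_mx raddfN opprK.
Qed.

Lemma sum_reflect (V : nmodType) (s : G) (F : G -> V) :
  \sum_x F x = \sum_x F (- (x + s)).
Proof.
rewrite (reindex_inj (h := fun x => - (x + s))) // => x y /oppr_inj.
exact: addIr.
Qed.

(** The reflection [x -> - (x + s)] exchanges [x] and [x + s] up to sign. As [X] is even, [Y] odd
    and [C] even up to transposition, the two halves of each mixed sum cancel. *)
Lemma clifford_step_autocor h (C : G -> 'M[R]_h) X Y kappa :
    (forall x, C (- x) = (C x)^T) -> (forall x, X (- x) = X x) ->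
    (forall x, Y (- x) = - Y x) -> has_autocor C kappa ->
  has_autocor (clifford_step C X Y)
    (fun s => kappa s + autocor X s + autocor Y s).
Proof.
move=> CN XN YN corC s.
have refl' x : - (x + s) + s = - x by rewrite opprD subrK.
have cr1 : \sum_x (Y x *: (C (x + s))^T + Y (x + s) *: C x) = 0.
  rewrite big_split /= [X in _ + X](sum_reflect s) -big_split /= big1 // => x _.
  by rewrite refl' YN CN scaleNr addrN.
have cr2 : \sum_x (X x *: (C (x + s))^T - X (x + s) *: C x) = 0.
  rewrite big_split /= [X in _ + X](sum_reflect s) -big_split /= big1 // => x _.
  by rewrite refl' XN CN addrN.
have cr3 : \sum_x (X x * Y (x + s) + Y x * X (x + s)) = 0.
  rewrite big_split /= [X in _ + X](sum_reflect s) -big_split /= big1 // => x _.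
  by rewrite refl' XN YN; ring.
rewrite (eq_bigr (fun x => block_mx
   ((X x * X (x + s))%:M + (Y x * Y (x + s))%:M + C x *m (C (x + s))^T +
     (Y x *: (C (x + s))^T + Y (x + s) *: C x))
   ((X x *: (C (x + s))^T - X (x + s) *: C x)
      - (X x * Y (x + s) + Y x * X (x + s))%:M)
   (- (X x *: (C (x + s))^T - X (x + s) *: C x)
      - (X x * Y (x + s) + Y x * X (x + s))%:M)
   ((X x * X (x + s))%:M + (Y x * Y (x + s))%:M + C x *m (C (x + s))^T -
     (Y x *: (C (x + s))^T + Y (x + s) *: C x)))); last first.
  move=> x _; rewrite /clifford_step tr_block_mx mulmx_block.
  rewrite !linearD !linearN /= !tr_scalar_mx.
  rewrite !(mulmxDl, mulmxDr, mulNmx, mulmxN, mul_scalar_mx, mul_mx_scalar).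
  congr block_mx; apply/matrixP => i j; rewrite !mxE; ring.
have block_sum (A1 A2 A3 A4 : G -> 'M[R]_h) :
    \sum_x block_mx (A1 x) (A2 x) (A3 x) (A4 x) =
    block_mx (\sum_x A1 x) (\sum_x A2 x) (\sum_x A3 x) (\sum_x A4 x).
  elim: (index_enum _) => [|x r IHr]; first by rewrite !big_nil block_mx0.
  by rewrite !big_cons IHr add_block_mx.
have scal_sum (f : G -> R) : \sum_x (f x)%:M = (\sum_x f x)%:M :> 'M[R]_h.
  by rewrite raddf_sum.
rewrite block_sum !big_split /= !sumrN !scal_sum.
move: cr1 cr2 cr3; rewrite !big_split /= !sumrN => cr1 cr2 cr3.
rewrite -!opprD cr1 cr2 cr3 corC !raddf0 !addr0 /=.
rewrite scalar_mx_block oppr0 -!raddfD /= /autocor.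
by congr block_mx; congr scalar_mx; ring.
Qed.

(** Only one of the three components survives, so each block row reduces to a single block. *)
Lemma preserves_signs_block h (x y : R) (A : 'M[R]_h) :
  [\/ [/\ preserves_signs A, x = 0 & y = 0], [/\ A = 0, x ^+ 2 = 1 & y = 0]
    | [/\ A = 0, x = 0 & y ^+ 2 = 1]] ->
  preserves_signs (block_mx x%:M (A + y%:M) (A - y%:M) (- x%:M)).
Proof.
move=> cases k F sF.
have sF1 : signmx (usubmx F) by move=> i j; rewrite mxE.
have sF2 : signmx (dsubmx F) by move=> i j; rewrite mxE.
rewrite -(vsubmxK F) mul_block_col.
have scal (c : R) (B : 'M[R]_(h, k)) : c ^+ 2 = 1 -> signmx B -> signmx (c%:M *m B).
  by move=> c1 sB i j; rewrite mul_scalar_mx mxE exprMn c1 sB mul1r.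
have neg (B : 'M[R]_(h, k)) : signmx B -> signmx (- B).
  by move=> sB i j; rewrite mxE sqrrN.
have col (B1 B2 : 'M[R]_(h, k)) : signmx B1 -> signmx B2 -> signmx (col_mx B1 B2).
  by move=> s1 s2 i j; rewrite mxE; case: splitP.
apply: col; case: cases => -[A1 x1 y1]; subst;
 rewrite ?raddf0 ?addr0 ?subr0 ?oppr0 ?mul0mx ?add0r ?addr0 ?sub0r ?mulNmx //;
 by [apply: A1 | apply: scal | apply: neg; apply: scal | move=> *; apply: scal].
Qed.

End Clifford.

(** * Hadamard matrices *)

Section Hadamard.
Variable R : realFieldType.

Definition hadamard (T : finType) (A : T -> T -> R) :=
  (forall x y, A x y ^+ 2 = 1) /\
  (forall x y, \sum_z A x z * A y z = #|T|%:R * (x == y)%:R).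

(** Sylvester's doubling. These matrices will turn the sparse blocks [C x] into blocks of signs. *)
Lemma sylvester s :
  exists2 F : 'M[R]_(2 ^ s), signmx F & F *m F^T = (2 ^ s)%:R%:M.
Proof.
elim: s => [|s [F sF FF]].
  by exists 1%:M => [i j|]; rewrite ?trmx1 ?mulmx1 // !ord1 mxE eqxx expr1n.
rewrite expnS mul2n -addnn; exists (block_mx F F F (- F)).
  move=> i j; rewrite mxE; case: splitP => i' _; rewrite mxE;
  by case: splitP => j' _; rewrite ?mxE ?sqrrN sF.
rewrite tr_block_mx mulmx_block linearN /= !(mulNmx, mulmxN) opprK FF addrN.
by rewrite scalar_mx_block natrD raddfD.
Qed.

(** In the inner product of two rows [F *m F^T] appears in the middle and leaves the factor [h];
    what remains is the autocorrelation of [C] at [y - x]. *)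
Lemma hadamard_of_autocor (G : finZmodType) h (C : G -> 'M[R]_h)
    (F : 'M[R]_h) :
    (forall x, preserves_signs (C x)) ->
    has_autocor C (fun s => #|G|%:R * (s == 0)%:R) ->
    signmx F -> F *m F^T = h%:R%:M ->
  hadamard (fun p q : G * 'I_h => (C (p.1 - q.1) *m F) p.2 q.2).
Proof.
move=> sC corC sF FF; split=> [p q|[x u] [y v]]; first exact: sC.
rewrite -(pair_bigA _ (fun z w =>
  (C (x - z) *m F) u w * (C (y - z) *m F) v w)) /=.
transitivity ((h%:R *: \sum_z C z *m (C (z + (y - x)))^T) u v).
  rewrite scaler_sumr summxE.
  rewrite (reindex_inj (h := fun z => x - z) (inv_inj (subKr x))) /=.
  apply: eq_bigr => z _.
  have -> : x - (x - z) = z by rewrite subKr.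
  have -> : y - (x - z) = z + (y - x) by rewrite opprB [LHS]addrCA.
  transitivity ((C z *m F *m (C (z + (y - x)) *m F)^T) u v).
    by rewrite [RHS]mxE; apply: eq_bigr => w _; rewrite [X in _ = _ * X]mxE.
  rewrite trmx_mul mulmxA -[_ *m F *m _]mulmxA FF mul_mx_scalar.
  by rewrite -scalemxAl.
rewrite corC !mxE subr_eq0 eq_sym card_prod card_ord natrM xpair_eqE.
by do 2 case: eqP => _ /=; rewrite ?mulr1n ?mulr0n ?mulr1 ?mulr0 // mulrC.
Qed.

(** A right inverse of a square matrix is also a left inverse. *)
Lemma hadamard_cols (T : finType) (A : T -> T -> R) : hadamard A ->
  forall x y, \sum_z A z x * A z y = #|T|%:R * (x == y)%:R.
Proof.
move=> [_ rowA] x y.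
have T_neq0 : #|T|%:R != 0 :> R by rewrite pnatr_eq0 -lt0n; apply/card_gt0P; exists x.
pose M : 'M[R]_#|T| := \matrix_(i, j) A (enum_val i) (enum_val j).
have sumT (F : T -> R) : \sum_z F z = \sum_(i < #|T|) F (enum_val i).
  by rewrite (reindex (@enum_val _ T)) //; apply/onW_bij/enum_val_bij.
have MM : M *m ((#|T|%:R)^-1 *: M^T) = 1%:M.
  rewrite -scalemxAr; apply/matrixP => i j; rewrite !mxE.
  under eq_bigr do rewrite !mxE.
  rewrite -(sumT (fun z => A (enum_val i) z * A (enum_val j) z)) rowA mulKf //.
  by rewrite (inj_eq enum_val_inj).
move/mulmx1C/matrixP/(_ (enum_rank x) (enum_rank y)): MM.
rewrite -scalemxAl !mxE (inj_eq enum_rank_inj) => /(congr1 ( *%R #|T|%:R)).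
rewrite mulrA divff // mul1r => <-; rewrite sumT.
by apply: eq_bigr => i _; rewrite !mxE !enum_rankK.
Qed.

(** The double sum factors into an inner product of rows and one of columns. *)
Lemma hadamard_square (T : finType) (A : T -> T -> R) : hadamard A ->
  hadamard (fun p q : T * T => A p.1 q.2 * A q.1 p.2).
Proof.
move=> hA; split=> [p q|[i j] [i' j']]; first by rewrite exprMn !(proj1 hA) mulr1.
rewrite -(pair_bigA _ (fun k l => A i l * A k j * (A i' l * A k j'))) /=.
transitivity ((\sum_l A i l * A i' l) * (\sum_k A k j * A k j')).
  rewrite mulrC mulr_suml; apply: eq_bigr => k _; rewrite mulr_sumr.
  by apply: eq_bigr => l _; ring.
rewrite (proj2 hA) (hadamard_cols hA) card_prod natrM xpair_eqE.
by do 2 case: eqP => _ /=; ring.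
Qed.

End Hadamard.

(** * Golay pairs *)

Section Golay.
Variable R : realFieldType.

(* The vanishing of the aperiodic autocorrelations, expressed by duality: the
   arbitrary weight [g] picks out the pairs of positions at a given distance. *)
Definition golay l (a b : nat -> R) :=
  [/\ forall k, a k ^+ 2 = 1, forall k, b k ^+ 2 = 1
    & forall g : int -> R,
        \sum_(i < l) \sum_(j < l) (a i * a j + b i * b j) * g (i%:Z - j%:Z) =
        (2 * l)%:R * g 0].

Lemma sum_ord_mul (V : nmodType) m n (F : nat -> V) :
  \sum_(k < m * n) F k = \sum_(q < m) \sum_(r < n) F (q * n + r)%N.
Proof.
elim: m => [|m IHm]; first by rewrite !big_ord0.
by rewrite mulSnr big_split_ord big_ord_recr /= IHm.
Qed.

Lemma sum_antidiag l (F : nat -> nat -> R) (g : int -> R) :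
  \sum_(i < l) \sum_(j < l) F i j * g (i%:Z - j%:Z) =
  \sum_(i < l) \sum_(j < l) F (l - j.+1)%N (l - i.+1)%N * g (i%:Z - j%:Z).
Proof.
rewrite exchange_big (reindex_inj rev_ord_inj) /=; apply: eq_bigr => i _.
rewrite (reindex_inj rev_ord_inj) /=; apply: eq_bigr => j _.
congr (_ * g _); have := ltn_ord i; have := ltn_ord j; lia.
Qed.

Lemma golay0 : golay 0 (fun=> 1) (fun=> 1).
Proof.
by split=> [k|k|g]; rewrite ?expr1n // big_ord0 muln0 mul0r.
Qed.

Lemma golay1 : golay 1 (fun=> 1) (fun=> 1).
Proof.
by split=> [k|k|g]; rewrite ?expr1n // !big_ord1 subrr /=; ring.
Qed.

Lemma golay2 : golay 2 (fun=> 1) (fun k => (-1) ^+ k).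
Proof.
split=> [k|k|g]; rewrite ?expr1n ?sqrr_sign //.
by rewrite !big_ord_recl !big_ord0 /= /bump /= !subrr expr0 expr1; ring.
Qed.

(* Turyn's product *)
Lemma golayM l l' a b c d : (0 < l)%N -> golay l a b -> golay l' c d ->
  exists a' b', golay (l' * l) a' b'.
Proof.
move=> l_gt0 [a1 b1 gab] [c1 d1 gcd].
(* Half sum and half difference have disjoint supports and are signs where they do not vanish. *)
pose s r := (a r + b r) / 2; pose t r := (a r - b r) / 2.
have sst r : s r ^+ 2 + t r ^+ 2 = 1.
  by transitivity ((a r ^+ 2 + b r ^+ 2) / 2);
    [rewrite /s /t; field | rewrite a1 b1; field].
have st r : s r * t r = 0.
  by transitivity ((a r ^+ 2 - b r ^+ 2) / 4);
    [rewrite /s /t; field | rewrite a1 b1; field].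
have sgn (x y : R) r : x ^+ 2 = 1 -> y ^+ 2 = 1 -> (x * s r + y * t r) ^+ 2 = 1.
  move=> x1 y1; rewrite sqrrD mulrACA st mulr0 mul0rn addr0.
  by rewrite (exprMn _ x) (exprMn _ y) x1 y1 !mul1r.
pose p k := c (k %/ l)%N * s (k %% l)%N + d (l' - (k %/ l).+1)%N * t (k %% l)%N.
pose q k := d (k %/ l)%N * s (k %% l)%N - c (l' - (k %/ l).+1)%N * t (k %% l)%N.
exists p, q; split=> [k|k|g]; first exact: sgn.
  by rewrite /q -mulNr; apply: sgn; rewrite ?sqrrN.
have divE (i : nat) (r : 'I_l) : ((i * l + r) %/ l = i)%N.
  by rewrite divnMDl // divn_small ?addn0.
have modE (i : nat) (r : 'I_l) : ((i * l + r) %% l = r)%N.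
  by rewrite modnMDl modn_small.
rewrite (sum_ord_mul l' l (fun k => \sum_(j < l' * l)
  (p k * p j + q k * q j) * g (k%:Z - j%:Z))) exchange_big /=.
transitivity (\sum_(r < l) \sum_(r' < l)
   (s r * s r' + t r * t r') * ((2 * l')%:R * g (r%:Z - r'%:Z))).
  apply: eq_bigr => r _.
  transitivity (\sum_(i < l') \sum_(j < l') \sum_(r' < l)
    (p (i * l + r)%N * p (j * l + r')%N + q (i * l + r)%N * q (j * l + r')%N) *
      g ((i * l + r)%N%:Z - (j * l + r')%N%:Z)).
    apply: eq_bigr => i _; exact: (sum_ord_mul l' l (fun j =>
      (p (i * l + r)%N * p j + q (i * l + r)%N * q j) * g ((i * l + r)%N%:Z - j%:Z))).
  under eq_bigr do rewrite exchange_big /=.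
  rewrite exchange_big /=; apply: eq_bigr => r' _.
  (* With [r] and [r'] fixed the weight depends only on [i - j], so the Golay property of [c] and
     [d] applies to it. *)
  pose h (z : int) := g (z * l%:Z + (r%:Z - r'%:Z)).
  have -> : g (r%:Z - r'%:Z) = h 0 by rewrite /h mul0r add0r.
  rewrite -gcd.
  have gE (i j : nat) : g ((i * l + r)%N%:Z - (j * l + r')%N%:Z) = h (i%:Z - j%:Z).
    by rewrite /h !PoszD !PoszM; congr g; ring.
  pose T (F : nat -> nat -> R) := \sum_(i < l') \sum_(j < l') F i j * h (i%:Z - j%:Z).
  have TD x y F F' : T (fun i j => x * F i j + y * F' i j) = x * T F + y * T F'.
    rewrite /T !mulr_sumr -big_split; apply: eq_bigr => i _ /=.
    by rewrite !mulr_sumr -big_split; apply: eq_bigr => j _ /=; ring.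
  have revK (F : nat -> nat -> R) : T F = T (fun i j => F (l' - j.+1)%N (l' - i.+1)%N).
    exact: sum_antidiag.
  have revE F F' : (forall i j, (i < l')%N -> (j < l')%N -> F i j = F' i j) -> T F = T F'.
    by move=> FF'; apply: eq_bigr => i _; apply: eq_bigr => j _; rewrite FF'.
  have rr i : (i < l')%N -> (l' - (l' - i.+1).+1 = i)%N by lia.
  pose n i := (l' - i.+1)%N.
  (* By reversal the terms in [t r * t r'] have the same correlations as those in [s r * s r'], and
     the mixed terms cancel in pairs. *)
  have T1 : T (fun i j => d (n i) * d (n j) + c (n i) * c (n j)) =
            T (fun i j => c i * c j + d i * d j).
    by rewrite revK; apply: revE => i j il jl; rewrite /n !rr //; ring.
  have T2 : T (fun i j => c i * d (n j)) = T (fun i j => d i * c (n j)).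
    by rewrite revK; apply: revE => i j il jl; rewrite /n !rr //; ring.
  have T3 : T (fun i j => d (n i) * c j) = T (fun i j => c (n i) * d j).
    by rewrite revK; apply: revE => i j il jl; rewrite /n !rr //; ring.
  transitivity (T (fun i j => 1 * (s r * s r' * (c i * c j + d i * d j) +
     t r * t r' * (d (n i) * d (n j) + c (n i) * c (n j))) +
     1 * (s r * t r' * (1 * (c i * d (n j)) + (-1) * (d i * c (n j))) +
     t r * s r' * (1 * (d (n i) * c j) + (-1) * (c (n i) * d j))))).
    apply: eq_bigr => i _; apply: eq_bigr => j _; rewrite gE; congr (_ * _).
    by rewrite /p /q !divE !modE /n; ring.
  by rewrite !TD T1 T2 T3 /T; ring.
transitivity (l'%:R * \sum_(r < l) \sum_(r' < l)
   (a r * a r' + b r * b r') * g (r%:Z - r'%:Z)).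
  rewrite mulr_sumr; apply: eq_bigr => r _; rewrite mulr_sumr.
  by apply: eq_bigr => r' _; rewrite /s /t natrM; field.
by rewrite gab !natrM; ring.
Qed.



(** A Golay pair of length 10, stored as exponents of -1; the default 0 gives the sign 1 past the
    end. *)
Definition golay10a (k : nat) : R := (-1) ^+ nth 0%N [:: 0;0;1;0;1;0;1;1;0;0]%N k.
Definition golay10b (k : nat) : R := (-1) ^+ nth 0%N [:: 0;0;1;0;0;0;0;0;1;1]%N k.

(** Shift invariance brings each [G i j] to one with a zero index, which leaves a polynomial
    identity. *)
Lemma golay10_sum (G : nat -> nat -> R) :
    (forall i j, G i.+1 j.+1 = G i j) ->
  \sum_(i < 10) \sum_(j < 10)
    (golay10a i * golay10a j + golay10b i * golay10b j) * G i j = 20 * G 0%N 0%N.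
Proof.
move=> GS; rewrite !big_ord_recl !big_ord0 /= /bump /= !add1n !GS.
by rewrite /golay10a /golay10b /= !expr1 !expr0; ring.
Qed.

Lemma golay10 : golay 10 golay10a golay10b.
Proof.
split=> [k|k|g]; rewrite ?sqrr_sign //.
rewrite (golay10_sum (G := fun i j => g (i%:Z - j%:Z))) ?subrr // => i j.
by congr g; lia.
Qed.

(** The length 0 serves as padding, to bring a list of lengths to a prescribed size. *)
Inductive golay_length : nat -> Prop :=
 | GolayLength0 : golay_length 0
 | GolayLength a b : golay_length (2 ^ a * 10 ^ b).

Lemma golay_lengthP l : golay_length l -> exists a b, golay l a b.
Proof.
case=> [|e e']; first by eexists _, _; exact: golay0.
elim: e => [|e [a [b gab]]].
  elim: e' => [|e' [a [b gab]]]; first by eexists _, _; exact: golay1.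
  rewrite mul1n in gab; rewrite mul1n expnS.
  by apply: golayM gab golay10; rewrite expn_gt0.
by rewrite expnS -mulnA; apply: golayM gab golay2; rewrite muln_gt0 !expn_gt0.
Qed.

End Golay.

(** * Hadamard matrices from Golay pairs *)

HB.instance Definition _ (U V : finZmodType) := GRing.Zmodule.on (U * V)%type.

Section Circulant.
Variable R : realFieldType.

(** * Even and odd extensions of a sequence *)

Section Extension.
Variable Z : finZmodType.
Local Notation G := (Z * 'I_2)%type (only parsing).

(** The two layers of [Z * 'I_2] keep the supports disjoint. There is no factor 1/2 because in the
    application [f x] and [f (- x)] are never both nonzero. *)
Definition even_ext (f : Z -> R) (p : G) := (f p.1 + f (- p.1)) * (p.2 == 0)%:R.
Definition odd_ext (f : Z -> R) (p : G) := (f p.1 - f (- p.1)) * (p.2 != 0)%:R.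

Lemma oppr_ord2 (w : 'I_2) : - w = w.
Proof. by apply/val_inj; case: w => [[|[|]]]. Qed.

Lemma even_extN f p : even_ext f (- p) = even_ext f p.
Proof. by rewrite /even_ext /= opprK addrC oppr_ord2. Qed.

Lemma odd_extN f p : odd_ext f (- p) = - odd_ext f p.
Proof. by rewrite /odd_ext /= opprK oppr_ord2 -mulNr opprB. Qed.

(* The terms in [f x * f (- (x + s))] cancel between the two extensions. *)
Lemma autocor_ext f s :
  autocor (even_ext f) s + autocor (odd_ext f) s =
  4 * (s.2 == 0)%:R * autocor f s.1.
Proof.
case: s => s w /=; rewrite /autocor.
rewrite -(pair_bigA _ (fun x v => even_ext f (x, v) * even_ext f (x + s, v + w))) /=.
rewrite -(pair_bigA _ (fun x v => odd_ext f (x, v) * odd_ext f (x + s, v + w))) /=.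
have reflE : \sum_x f (- x) * f (- (x + s)) = \sum_x f x * f (x + s).
  rewrite [RHS](sum_reflect s); apply: eq_bigr => x _.
  by rewrite opprD subrK mulrC.
transitivity (2 * (w == 0)%:R *
    (\sum_x f x * f (x + s) + \sum_x f (- x) * f (- (x + s)))); last first.
  by rewrite reflE; ring.
rewrite -!big_split mulr_sumr; apply: eq_bigr => x _.
rewrite !big_ord_recl !big_ord0 /even_ext /odd_ext /=.
rewrite (_ : lift ord0 ord0 = 1 :> 'I_2); last exact/val_inj.
rewrite (_ : ord0 + w = w :> 'I_2); last by rewrite add0r.
have [->|w1] : w = 0 \/ w = 1.
  by case: w => [[|[|]] // lw]; [left|right]; apply/val_inj.
  by rewrite addr0 /=; ring.
by rewrite w1 (_ : 1 + 1 = 0 :> 'I_2) /=; [ring | exact/val_inj].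
Qed.

Variable u : Z.

(** A sum of point masses, so that [autocor_place] holds even if multiples of [u] coincide. *)
Definition place (a : nat -> R) d l x : R :=
  \sum_(k < l) a k * (x == u *+ (d + k.+1))%:R.

Lemma autocor_place a d l s :
  autocor (place a d l) s =
  \sum_(i < l) \sum_(j < l) a i * a j * (s == - (u *~ (i%:Z - j%:Z)))%:R.
Proof.
rewrite /autocor /place.
under eq_bigr do rewrite mulr_suml.
rewrite exchange_big /=; apply: eq_bigr => i _.
rewrite (bigD1 (u *+ (d + i.+1))) //= eqxx mulr1 [X in _ + X]big1 ?addr0; last first.
  by move=> x /negPf->; rewrite mulr0 mul0r.
rewrite mulr_sumr; apply: eq_bigr => j _; rewrite mulrA; congr (_ * _%:R).
rewrite -[s == _](inj_eq (addrI (u *+ (d + i.+1)))); congr (_ == _).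
by rewrite !pmulrn -mulrNz -mulrzDr; congr (_ *~ _); lia.
Qed.

(** The indicator of [s = - (u *~ z)], taken as the weight, makes the aperiodic identity periodic.
    The offsets may differ, since a shift does not change an autocorrelation. *)
Lemma autocor_golay a b d d' l s : golay l a b ->
  autocor (place a d l) s + autocor (place b d' l) s = (2 * l)%:R * (s == 0)%:R.
Proof.
move=> [_ _ /(_ (fun z => (s == - (u *~ z))%:R))].
rewrite mulr0z oppr0 => <-; rewrite !autocor_place -big_split.
apply: eq_bigr => i _; rewrite -big_split; apply: eq_bigr => j _ /=.
by rewrite mulrDl.
Qed.

End Extension.

(** * Filling a cyclic group of odd order *)

Section Interval.
Variable M : nat.
Local Notation Z := 'I_(M.*2).+1.
Local Notation G := (Z * 'I_2)%type (only parsing).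

(** The distance from [x] to 0 on the cycle. *)
Definition mag (x : Z) := minn x (M.*2.+1 - x).

Definition one_mod : Z := inZp 1.

Lemma one_modMn k : (k <= M.*2)%N -> one_mod *+ k = k :> nat.
Proof. by move=> kM; rewrite Zp_mulrn /= modnMml mul1n modn_small. Qed.

Lemma oppZ_val (x : Z) : x != 0 -> - x = (M.*2.+1 - x)%N :> nat.
Proof.
rewrite -val_eqE /= => x0; rewrite modn_small //.
by have := ltn_ord x; lia.
Qed.

Lemma place_val a d l (x : Z) : (d + l <= M)%N ->
  place one_mod a d l x = if (d < x <= d + l)%N then a (x - d.+1)%N else 0.
Proof.
move=> dlM; rewrite /place.
have ptE (k : 'I_l) : (x == one_mod *+ (d + k.+1)) = (x == d + k.+1 :> nat)%N.
  by rewrite -val_eqE /= one_modMn //; have := ltn_ord k; lia.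
under eq_bigr do rewrite ptE.
case: ifP => [/andP[dx xdl]|x_out]; last first.
  rewrite big1 // => k _; case: eqP => [xE|]; rewrite ?mulr0 //.
  by move: x_out; have := ltn_ord k; lia.
have kl : (x - d.+1 < l)%N by lia.
rewrite (bigD1 (Ordinal kl)) //= (_ : _ == _ = true) ?mulr1; last by lia.
rewrite big1 ?addr0 // => k; rewrite -val_eqE /= => k_neq.
by rewrite (_ : _ == _ = false) ?mulr0 //; lia.
Qed.

(* Every nonzero residue is [x] or [- x] for a unique [0 < x <= M]. *)
Lemma place_in a d l (x : Z) : (forall k, a k ^+ 2 = 1) -> (d + l <= M)%N ->
  (d < mag x <= d + l)%N ->
  (place one_mod a d l x + place one_mod a d l (- x)) ^+ 2 = 1 /\
  (place one_mod a d l x - place one_mod a d l (- x)) ^+ 2 = 1.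
Proof.
move=> a1 dlM; rewrite /mag => x_in.
have x0 : x != 0 by rewrite -val_eqE /=; lia.
rewrite !place_val // oppZ_val //; have := ltn_ord x.
case: ifP => hx; case: ifP => hNx; rewrite ?addr0 ?subr0 ?add0r ?sub0r ?sqrrN;
 rewrite ?a1 //; lia.
Qed.

Lemma place_out a d l (x : Z) : (d + l <= M)%N ->
  (mag x <= d)%N || (d + l < mag x)%N ->
  place one_mod a d l x = 0 /\ place one_mod a d l (- x) = 0.
Proof.
move=> dlM; rewrite /mag => x_out; rewrite !place_val //.
have [->|x0] := eqVneq x 0; first by rewrite oppr0.
rewrite oppZ_val //; have := ltn_ord x.
case: ifP => hx; case: ifP => hNx //; lia.
Qed.

Lemma mag0 (x : Z) : (mag x == 0)%N = (x == 0).
Proof. by rewrite /mag -val_eqE /=; have := ltn_ord x; lia. Qed.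

Lemma mag_le (x : Z) : (mag x <= M)%N.
Proof. by rewrite /mag; have := ltn_ord x; lia. Qed.

(** Invariant of the construction: the ball of radius [d] is filled, the rest is still empty. *)
Definition clifford_up_to d h (C : G -> 'M[R]_h) (kappa : G -> R) :=
  [/\ forall p, C (- p) = (C p)^T, has_autocor C kappa,
      forall p, (mag p.1 <= d)%N -> preserves_signs (C p)
    & forall p, (d < mag p.1)%N -> C p = 0].

(** Point masses cover the ball of radius 0: [C0] takes [(0, 0)] and [X] takes [(0, 1)]. *)
Lemma clifford_start :
  exists C : G -> 'M[R]_(1 + 1), clifford_up_to 0 C (fun s => 2 * (s == 0)%:R).
Proof.
pose C0 (p : G) : 'M[R]_1 := (p == 0)%:R%:M.
pose X (p : G) : R := (p == (0, 1))%:R.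
have C0N p : C0 (- p) = (C0 p)^T by rewrite /C0 oppr_eq0 tr_scalar_mx.
have delta_cor (q s : G) :
    \sum_p (p == q)%:R * (p + s == q)%:R = (s == 0)%:R :> R.
  rewrite (bigD1 q) //= eqxx mul1r big1 ?addr0; last first.
    by move=> p /negPf->; rewrite mul0r.
  by rewrite -{2}[q]addr0 (inj_eq (addrI q)).
have C0cor : has_autocor C0 (fun s => (s == 0)%:R).
  move=> s; rewrite -(delta_cor 0) raddf_sum; apply: eq_bigr => p _ /=.
  by rewrite /C0 tr_scalar_mx -scalar_mxM.
have XN p : X (- p) = X p.
  by rewrite /X -(inj_eq oppr_inj) opprK; congr (_ == _)%:R; congr pair;
    rewrite ?oppr0 ?oppr_ord2.
exists (clifford_step C0 X (fun=> 0)); split.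
- by move=> p; apply: (clifford_step_tr C0N XN) => q; rewrite oppr0.
- move=> s; rewrite (clifford_step_autocor C0N XN _ C0cor) => [|p]; last first.
    by rewrite oppr0.
  congr scalar_mx; rewrite {1}/autocor delta_cor /autocor big1 ?addr0 => [|p _].
    by ring.
  by rewrite mul0r.
- move=> [x w]; rewrite leqn0 mag0 /= => /eqP ->.
  apply: preserves_signs_block.
  have [->|->] : w = 0 \/ w = 1.
    by case: w => [[|[|]] // lw]; [left|right]; apply/val_inj.
  + by apply: Or31; split=> // k F sF; rewrite /C0 eqxx mul1mx.
  + by apply: Or32; rewrite /X eqxx expr1n; split=> //; apply: raddf0.
move=> [x w]; rewrite lt0n mag0 /= => /negPf x0.
rewrite /clifford_step /C0 /X !xpair_eqE x0 /= !(raddf0, addr0, oppr0).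
exact: block_mx0.
Qed.

(** The new sequence lives on the shell [d < mag x <= d + l], where [C] vanishes; its even extension
    fills one layer of the shell and its odd extension the other. *)
Lemma clifford_place h (C : G -> 'M[R]_h) kappa a d l :
    (forall k, a k ^+ 2 = 1) -> (d + l <= M)%N -> clifford_up_to d C kappa ->
  exists C' : G -> 'M[R]_(h + h), clifford_up_to (d + l) C'
    (fun s => kappa s + 4 * (s.2 == 0)%:R * autocor (place one_mod a d l) s.1).
Proof.
move=> a1 dlM [CN Ccor Cin Cout]; set f := place one_mod a d l.
exists (clifford_step C (even_ext f) (odd_ext f)); split.
- by apply: clifford_step_tr => // p; rewrite ?even_extN ?odd_extN.
- move=> s; rewrite (clifford_step_autocor CN (even_extN f) (odd_extN f) Ccor).
  by rewrite -addrA autocor_ext.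
- move=> [x w] /= x_le; apply: preserves_signs_block.
  have [x_in|x_out] := leqP (mag x) d.
    have [fx fNx] : f x = 0 /\ f (- x) = 0 by apply: place_out; rewrite ?x_in.
    apply: Or31; split; first exact: Cin.
      by rewrite /even_ext /= fx fNx addr0 mul0r.
    by rewrite /odd_ext /= fx fNx subr0 mul0r.
  have [fe fo] : (f x + f (- x)) ^+ 2 = 1 /\ (f x - f (- x)) ^+ 2 = 1.
    by apply: place_in; rewrite ?x_out.
  rewrite /even_ext /odd_ext /=; have [->|w0] := eqVneq w 0.
    by apply: Or32; rewrite mulr1 mulr0; split=> //; apply: Cout.
  by apply: Or33; rewrite mulr1 mulr0; split=> //; apply: Cout.
move=> [x w] /= x_gt.
have [fx fNx] : f x = 0 /\ f (- x) = 0 by apply: place_out; rewrite ?x_gt ?orbT.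
rewrite /clifford_step /even_ext /odd_ext /= fx fNx Cout /=; last by lia.
by rewrite !(addr0, subr0, mul0r, raddf0, oppr0) block_mx0.
Qed.

(** Each Golay pair takes two consecutive shells of width [l], hence two doublings of the block
    size, and contributes [4 * (2 * l)] at [s = 0] only. *)
Lemma clifford_lengths (ls : seq nat) :
    (forall l, l \in ls -> golay_length l) -> (2 * sumn ls <= M)%N ->
  exists h (C : G -> 'M[R]_h), h = (2 ^ (2 * size ls).+1)%N /\
    clifford_up_to (2 * sumn ls) C (fun s => (2 + 8 * sumn ls)%:R * (s == 0)%:R).
Proof.
elim: ls => [|l ls IHls] lsP lsM.
  by have [C hC] := clifford_start; exists (1 + 1)%N, C.
have [||h [C [hE hC]]] := IHls; first by move=> k kls; apply: lsP; rewrite inE kls orbT.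
  by move: lsM => /=; lia.
have [a [b gab]] := golay_lengthP R (lsP l (mem_head _ _)).
have [a1 b1 _] := gab.
have lM : (2 * sumn ls + l <= M)%N by move: lsM => /=; lia.
have [C1 hC1] := clifford_place a1 lM hC.
have lM2 : (2 * sumn ls + l + l <= M)%N by move: lsM => /=; lia.
have [C2 hC2] := clifford_place b1 lM2 hC1.
exists (h + h + (h + h))%N, C2; split.
  by rewrite hE /= mulnS !expnS; lia.
have -> : (2 * sumn (l :: ls) = 2 * sumn ls + l + l)%N by rewrite /=; lia.
case: hC2 => C2N C2cor C2in C2out; split=> // s; rewrite C2cor; congr scalar_mx.
rewrite -addrA -mulrDr autocor_golay //.
have -> : (2 + 8 * sumn (l :: ls))%:R =
    (2 + 8 * sumn ls)%:R + 4 * (2 * l)%:R :> R.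
  by rewrite -natrM -natrD; congr _%:R; rewrite /=; lia.
case: s => s w; rewrite xpair_eqE /=.
by do 2 case: eqP => _ /=; ring.
Qed.

End Interval.

(** With [M = 2 * sumn ls] the shells exhaust the group, whose order [2 + 8 * sumn ls] is exactly
    the weight of the autocorrelation. *)
Lemma hadamard_lengths (ls : seq nat) :
    (forall l, l \in ls -> golay_length l) ->
  exists (T : finType) (A : T -> T -> R), hadamard A /\
    #|T| = ((1 + 4 * sumn ls) * 4 ^ (size ls).+1)%N.
Proof.
move=> lsP; set M := (2 * sumn ls)%N.
have [h [C [hE [CN Ccor Cin _]]]] := @clifford_lengths M ls lsP (leqnn M).
have [F sF FF] := sylvester R (2 * size ls).+1.
move: F sF FF; rewrite -hE => F sF FF.
have cardG : #|{: 'I_(M.*2).+1 * 'I_2}| = (2 + 8 * sumn ls)%N.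
  by rewrite card_prod !card_ord /M; lia.
exists _, (fun p q : 'I_(M.*2).+1 * 'I_2 * 'I_h => (C (p.1 - q.1) *m F) p.2 q.2).
split.
  apply: hadamard_of_autocor => // [p|s]; first exact/Cin/mag_le.
  by rewrite Ccor cardG.
have hE' : h = (2 * 4 ^ size ls)%N by rewrite hE expnS expnM.
rewrite card_prod cardG card_ord hE' expnS.
by move: (4 ^ _)%N (sumn ls) => q S; lia.
Qed.

End Circulant.

(** * Energy and traces *)

Section Energy.
Variable R : rcfType.
Local Notation C := (R[i])%C.
Local Open Scope complex_scope.
Local Open Scope sesquilinear_scope.

Lemma adjointmxE m n (A : 'M[C]_(m, n)) : adjointmx A = A ^t*.
Proof. by []. Qed.

Lemma sqrtC_real (z : C) : 0 <= z ->
  sqrtC z = (Num.sqrt (complex.Re z))%:C.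
Proof.
move=> z0; have z_re : z = (complex.Re z)%:C.
  by case: z z0 => x y; rewrite lecE /= => /andP[/eqP-> _].
have Re0 : 0 <= complex.Re z by move: z0; rewrite {1}z_re lecE /= eqxx.
have s0 : 0 <= (Num.sqrt (complex.Re z))%:C by rewrite lecR sqrtr_ge0.
rewrite -[RHS](sqrCK s0); congr sqrtC.
by rewrite -rmorphXn /= sqr_sqrtr.
Qed.

Lemma char_poly_conj n (P D : 'M[C]_n) : P \in unitmx ->
  char_poly (invmx P *m D *m P) = char_poly D.
Proof.
move=> uP; have uPp : map_mx polyC P \in unitmx by rewrite map_unitmx.
rewrite /char_poly /char_poly_mx !map_mxM map_invmx.
have -> : 'X%:M - invmx (map_mx polyC P) *m map_mx polyC D *m map_mx polyC P =
  invmx (map_mx polyC P) *m ('X%:M - map_mx polyC D) *m map_mx polyC P.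
  rewrite mulmxBr mulmxBl; congr (_ - _).
  by rewrite mul_mx_scalar -scalemxAl mulVmx // scalemx1.
rewrite !det_mulmx mulrAC -det_mulmx mulVmx // det1 mul1r //.
Qed.

(* Singular value decomposition in disguise: in an orthonormal eigenbasis of
   [A A^*] the rows of [A] have the singular values as norms. *)
Lemma energy_ge_trace n (A U : 'M[C]_n) : U *m adjointmx U = 1%:M ->
  complex.Re (\tr (A *m U)) <= energy A.
Proof.
rewrite adjointmxE => UU; pose K := A *m A ^t*.
have KH : K ^t* = K by rewrite /K trmx_mul map_mxM trmxCK.
have /orthomx_spectralP KE : K \is normalmx by apply/normalmxP; rewrite KH.
set P := spectralmx K in KE; set d := spectral_diag K in KE.
have uP : P \is unitarymx := spectral_unitarymx K.
have PP : P *m P ^t* = 1%:M by apply/unitarymxP.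
have PV : invmx P = P ^t* by rewrite invmx_unitary.
(* The rows of [B] are orthogonal with squared norms [d], those of [W ^t*] are orthonormal. *)
pose B := P *m A; pose W := U *m P ^t*.
have BB : B *m B ^t* = diag_mx d.
  rewrite /B trmx_mul map_mxM mulmxA -(mulmxA P) -/K KE PV.
  by rewrite !mulmxA PP mul1mx -mulmxA PP mulmx1.
have WW : W ^t* *m W = 1%:M.
  apply: mulmx1C; rewrite /W trmx_mul map_mxM trmxCK mulmxA -(mulmxA U).
  by rewrite -{1}PV mulVmx ?unitarymx_unit // mulmx1.
have trE : \tr (A *m U) = \sum_i (B *m W) i i.
  rewrite -/(\tr (B *m W)) [RHS]mxtrace_mulC /W /B -mulmxA (mulmxA _ P).
  by rewrite -PV mulVmx ?unitarymx_unit // mul1mx mxtrace_mulC.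
have dE i : dotmx (row i B) (row i B) = d 0 i.
  move/matrixP/(_ i i): BB; rewrite [RHS]mxE eqxx mulr1n => <-.
  by rewrite dotmxE !mxE; apply: eq_bigr => j _; rewrite !mxE.
have d0 i : 0 <= d 0 i.
  rewrite -dE dotmxE mxE sumr_ge0 // => j _.
  by rewrite !mxE mul_conjC_ge0.
(* Cauchy-Schwarz for row [i] of [B] and a unit vector. *)
have le_d i : `|(B *m W) i i| <= sqrtC (d 0 i).
  have le_dot : `|dotmx (row i B) (row i (W ^t*))| <=
      sqrtC (dotmx (row i B) (row i B)) *
      sqrtC (dotmx (row i (W ^t*)) (row i (W ^t*))).
    by case: (CauchySchwarz_sqrt (@dotmx C n) (row i B) (row i (W ^t*))).
  have dW : dotmx (row i (W ^t*)) (row i (W ^t*)) = 1.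
    move/matrixP/(_ i i): WW; rewrite [RHS]mxE eqxx mulr1n => <-.
    by rewrite dotmxE !mxE; apply: eq_bigr => j _; rewrite !mxE conjCK.
  move: le_dot; rewrite dE dW sqrtC1 mulr1; congr (`|_| <= _).
  by rewrite dotmxE !mxE; apply: eq_bigr => j _; rewrite !mxE conjCK.
have charK : \prod_(z <- eigenvalues K) ('X - z%:P) =
             \prod_(z <- [seq d 0 i | i <- enum 'I_n]) ('X - z%:P).
  rewrite -eigenvaluesP KE char_poly_conj ?unitarymx_unit //.
  rewrite char_poly_trig ?diag_mx_is_trig // big_map big_enum /=.
  by apply: eq_bigr => i _; rewrite mxE eqxx mulr1n.
have eigE : perm_eq (eigenvalues K) [seq d 0 i | i <- enum 'I_n].
  exact: prod_XsubC_eq charK.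
have energyE : (energy A)%:C = \sum_i sqrtC (d 0 i).
  rewrite /energy /singular_values (perm_big _ (permEl (perm_sort _ _))) /=.
  rewrite big_map adjointmxE -/K (perm_big _ eigE) big_map big_enum rmorph_sum.
  by apply: eq_bigr => i _; rewrite sqrtC_real.
have : `|\tr (A *m U)| <= (energy A)%:C.
  rewrite trE energyE; apply: le_trans (ler_norm_sum _ _ _) _.
  exact: ler_sum.
case: (\tr _) => x y; rewrite normc_def lecR /=; apply: le_trans.
by apply: le_trans (ler_norm x) _; rewrite -sqrtr_sqr ler_wsqrtr // lerDl sqr_ge0.
Qed.
End Energy.

(** * The graph of a Hadamard matrix *)

Section HadamardGraph.
Variable R : rcfType.

Lemma energy_ge_trace_real n (A V : 'M[R]_n) : V *m V^T = 1%:M ->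
  \tr (A *m V) <= energy (map_mx (@real_complex R) A).
Proof.
move=> VV; set rc := @real_complex R.
have conj_rc (B : 'M[R]_n) : adjointmx (map_mx rc B) = map_mx rc B^T.
  by apply/matrixP => i j; rewrite !mxE conjc_real.
have UU : map_mx rc V *m adjointmx (map_mx rc V) = 1%:M.
  by rewrite conj_rc -map_mxM VV map_mx1.
apply: le_trans (energy_ge_trace _ UU).
by rewrite -map_mxM /= trace_map_mx.
Qed.

(** Orthogonality of the columns gives the row sums [r x] total square [N ^ 4]; then sum
    [2 N r x <= r x ^ 2 + N ^ 2] over the [N ^ 2] rows. *)
Lemma hadamard_sum_le (T : finType) (S : T -> T -> R) (N : nat) :
    hadamard S -> (0 < N)%N -> #|T| = (N ^ 2)%N ->
  \sum_x \sum_y S x y <= N%:R ^+ 3.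
Proof.
move=> hS N_gt0 cardT; pose r x := \sum_y S x y.
have N_gt0' : 0 < N%:R :> R by rewrite ltr0n.
have r2 : \sum_x r x ^+ 2 = N%:R ^+ 4.
  transitivity (\sum_y \sum_z \sum_x S x y * S x z).
    under [RHS]eq_bigr do rewrite exchange_big.
    rewrite [RHS]exchange_big; apply: eq_bigr => x _.
    by rewrite expr2 mulr_suml; apply: eq_bigr => y _; rewrite mulr_sumr.
  transitivity (\sum_(y : T) #|T|%:R : R).
    apply: eq_bigr => y _; rewrite (bigD1 y) //= (hadamard_cols hS) eqxx mulr1.
    rewrite big1 ?addr0 // => z; rewrite eq_sym (hadamard_cols hS) => /negPf->.
    by rewrite mulr0.
  by rewrite sumr_const -[LHS]mulr_natr cardT natrX -exprD.
have le_r x : N%:R * r x *+ 2 <= r x ^+ 2 + N%:R ^+ 2.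
  by have := sqr_ge0 (r x - N%:R); nra.
have : \sum_x N%:R * r x *+ 2 <= \sum_x (r x ^+ 2 + N%:R ^+ 2).
  by apply: ler_sum => x _.
rewrite [X in _ <= X]big_split /= r2 sumr_const -[X in _ <= _ + X]mulr_natr cardT natrX -exprD.
rewrite sumrMnl -mulr_sumr => le_sum.
rewrite -(ler_pM2l N_gt0') -exprS; lra.
Qed.

Lemma hadamard_graph (T : finType) (A : T -> T -> R) n :
    hadamard A -> (0 < #|T|)%N -> (#|T| ^ 2 <= n)%N ->
  exists G : simple_graph 'I_n,
    (#|T|%:R ^+ 3 - #|T|%:R ^+ 2) / 2 - #|T|%:R <= graph_energy R G.
Proof.
move=> hA; set N := #|T| => N_gt0 N2n.
pose S (p q : T * T) := A p.1 q.2 * A q.1 p.2.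
have hS : hadamard S := hadamard_square hA.
have SC p q : S p q = S q p by rewrite /S mulrC.
set K := #|{: T * T}|; have KE : K = (N ^ 2)%N by rewrite /K card_prod.
have KR : K%:R = N%:R ^+ 2 :> R by rewrite KE natrX.
have {n N2n} [e ->] : exists e, n = (K + e)%N.
  by exists (n - K)%N; rewrite KE subnKC.
pose Sm : 'M[R]_K := \matrix_(a, b) S (enum_val a) (enum_val b).
pose edge (a b : 'I_K) := (a != b) && (Sm a b == -1).
have edgeC a b : edge a b = edge b a by rewrite /edge eq_sym !mxE SC.
pose adjG (i j : 'I_(K + e)) :=
  match fintype.split i, fintype.split j with inl a, inl b => edge a b | _, _ => false end.
have adjC : symmetric adjG.
  by move=> i j; rewrite /adjG; case: fintype.split => a; case: fintype.split.
have adjI : irreflexive adjG.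
  by move=> i; rewrite /adjG; case: fintype.split => // a; rewrite /edge eqxx.
exists (SimpleGraph adjC adjI).
pose B : 'M[R]_K := \matrix_(a, b) (edge a b)%:R.
have adjE : adjacency_mx R (SimpleGraph adjC adjI) =
    map_mx (@real_complex R) (block_mx B 0 0 0 : 'M[R]_(K + e)).
  apply/matrixP => i j; rewrite !mxE /= /adjG.
  by case: fintype.split => a; rewrite !mxE; case: fintype.split => b; rewrite !mxE ?rmorph0 ?rmorph_nat.
pose V : 'M[R]_(K + e) := block_mx (- N%:R^-1 *: Sm) 0 0 1%:M.
have N_neq0 : N%:R != 0 :> R by rewrite pnatr_eq0 -lt0n.
have sumT (F : T * T -> R) : \sum_z F z = \sum_(i < K) F (enum_val i).
  by rewrite (reindex (@enum_val _ {: T * T})) //; apply/onW_bij/enum_val_bij.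
have VV : V *m V^T = 1%:M.
  rewrite tr_block_mx mulmx_block !trmx0 !mulmx0 !mul0mx !addr0 !add0r trmx1 mulmx1.
  rewrite scalar_mx_block; congr block_mx; rewrite linearZ /= -scalemxAl -scalemxAr.
  apply/matrixP => a b; rewrite !mxE; under eq_bigr do rewrite !mxE.
  rewrite -(sumT (fun z => S (enum_val a) z * S (enum_val b) z)) (proj2 hS) KR.
  rewrite (inj_eq enum_val_inj); case: eqP => _; rewrite ?mulr0 //.
  by field.
rewrite /graph_energy adjE; apply: le_trans (energy_ge_trace_real _ VV).
rewrite mulmx_block !mulmx0 !mul0mx !addr0 mxtrace_block mxtrace0 addr0.
rewrite -scalemxAr mxtraceZ.
(* Edges sit where [Sm] is -1, so each nonzero entry of [B] contributes 1. *)
have trE : - \tr (B *m Sm) = \sum_a \sum_b B a b.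
  rewrite -sumrN; apply: eq_bigr => a _; rewrite mxE -sumrN; apply: eq_bigr => b _.
  rewrite !mxE [S (enum_val b) _]SC /edge mxE.
  by case: (a == b); case: eqP => [->|_] /=; ring.
have constE (c : R) : \sum_(a < K) c = c * K%:R.
  by rewrite sumr_const card_ord -[LHS]mulr_natr.
have sumB : (K%:R ^+ 2 - \sum_p \sum_q S p q) / 2 - K%:R <= \sum_a \sum_b B a b.
  have -> : \sum_p \sum_q S p q = \sum_a \sum_b Sm a b.
    rewrite sumT; apply: eq_bigr => a _; rewrite sumT.
    by apply: eq_bigr => b _; rewrite mxE.
  (* Equality holds off the diagonal; the subtracted term pays for the missing loops, at a total
     cost of [K]. *)
  have le_B a b : (1 - Sm a b) / 2 - (a == b)%:R <= B a b.
    have : Sm a b ^+ 2 = 1 by rewrite mxE (proj1 hS).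
    move/eqP; rewrite sqrf_eq1 [B a b]mxE /edge => /orP[/eqP->|/eqP->].
      by case: (a == b); case: (1 == -1 :> R) => /=; lra.
    by rewrite eqxx; case: (a == b) => /=; lra.
  have : \sum_a \sum_b ((1 - Sm a b) / 2 - (a == b)%:R) <= \sum_a \sum_b B a b.
    by apply: ler_sum => a _; apply: ler_sum => b _.
  apply: le_trans; rewrite le_eqVlt; apply/orP; left; apply/eqP.
  transitivity (\sum_(a < K) (K%:R / 2 - (\sum_b Sm a b) / 2 - 1 : R)).
    by rewrite !sumrB -!mulr_suml !constE; field.
  apply: eq_bigr => a _; rewrite sumrB -!mulr_suml sumrB constE.
  have -> : \sum_b (a == b)%:R = 1 :> R.
    rewrite (bigD1 a) //= eqxx big1 ?addr0 // => b.
    by rewrite eq_sym => /negPf->.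
  by field.
have := hadamard_sum_le hS N_gt0 KE; rewrite -/K => sumS.
rewrite mulNr -mulrN trE [X in _ <= X]mulrC ler_pdivlMr ?ltr0n //; apply: le_trans sumB.
rewrite KR; set x := N%:R; have x_gt0 : 0 < x by rewrite ltr0n.
nra.
Qed.
End HadamardGraph.

(** * Density of the orders *)

Section Density.

(* The largest [2 ^ a * 10 ^ b] below [x] is close to [x], because trading
   [2 ^ p] for [10 ^ q], or [10 ^ q'] for [2 ^ p'], increases it only slightly. *)
Lemma golay_length_exchange p q p' q' x :
    (2 ^ p < 10 ^ q)%N -> (512 * 10 ^ q <= 513 * 2 ^ p)%N ->
    (10 ^ q' < 2 ^ p')%N -> (512 * 2 ^ p' <= 513 * 10 ^ q')%N ->
    (2 ^ p * 10 ^ q' <= x)%N ->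
  exists2 l, golay_length l & (l <= x)%N && (512 * (x - l) <= x)%N.
Proof.
move=> up_lt up_le dn_lt dn_le x_ge.
pose P y := (y <= x)%N &&
  [exists a : 'I_x.+1, exists b : 'I_x.+1, y == (2 ^ a * 10 ^ b)%N].
have PP a b : (2 ^ a * 10 ^ b <= x)%N -> P (2 ^ a * 10 ^ b)%N.
  move=> le_x; rewrite /P le_x /=.
  have a_gt0 : (0 < 2 ^ a)%N by rewrite expn_gt0.
  have b_gt0 : (0 < 10 ^ b)%N by rewrite expn_gt0.
  have ax : (a < x.+1)%N.
    by have := ltn_expl a (isT : 1 < 2)%N; nia.
  have bx : (b < x.+1)%N.
    by have := ltn_expl b (isT : 1 < 10)%N; nia.
  by apply/existsP; exists (Ordinal ax); apply/existsP; exists (Ordinal bx).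
have exP : exists y, P y by exists (2 ^ p * 10 ^ q')%N; apply: PP.
have leP y : P y -> (y <= x)%N by case/andP.
case: (ex_maxnP exP leP) => y /andP[y_le /existsP[a /existsP[b /eqP yE]]] y_max.
exists y; first by rewrite yE; constructor.
rewrite y_le /=.
suff [z z_gt z_le] : exists2 z, (x < z)%N & (512 * z <= 513 * y)%N.
  by move: y_le z_gt z_le; clear; lia.
have y_gt0 : (0 < y)%N by rewrite yE muln_gt0 !expn_gt0.
have ratio z u v : (0 < u)%N -> (z * u = y * v)%N -> (512 * v <= 513 * u)%N ->
    (512 * z <= 513 * y)%N.
  move=> u_gt0 zE uv; rewrite -(leq_pmul2r u_gt0) -mulnA zE.
  have : (y * (512 * v) <= y * (513 * u))%N by rewrite leq_mul2l uv orbT.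
  by clear; lia.
have out c d : (y < 2 ^ c * 10 ^ d)%N -> (x < 2 ^ c * 10 ^ d)%N.
  by move=> y_lt; rewrite ltnNge; apply/negP => /PP/y_max; rewrite leqNgt y_lt.
(* With enough factors 2 or 10 in [y], the exchange gives a slightly larger number of the same form,
   which exceeds [x] by maximality. Otherwise [y < 2 ^ p * 10 ^ q'], against maximality. *)
have [pa|ap] := leqP p a.
  have zE : (2 ^ (a - p) * 10 ^ (b + q) * 2 ^ p = y * 10 ^ q)%N.
    by rewrite yE -[in RHS](subnK pa) !expnD; ring.
  have p_gt0 : (0 < 2 ^ p)%N by rewrite expn_gt0.
  exists (2 ^ (a - p) * 10 ^ (b + q))%N; first by apply: out; nia.
  exact: ratio zE up_le.
have [qb|bq] := leqP q' b.
  have zE : (2 ^ (a + p') * 10 ^ (b - q') * 10 ^ q' = y * 2 ^ p')%N.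
    by rewrite yE -[in RHS](subnK qb) !expnD; ring.
  have q_gt0 : (0 < 10 ^ q')%N by rewrite expn_gt0.
  exists (2 ^ (a + p') * 10 ^ (b - q'))%N; first by apply: out; nia.
  exact: ratio zE dn_le.
have := y_max _ (PP _ _ x_ge).
have : (2 ^ a < 2 ^ p)%N by rewrite ltn_exp2l.
have : (10 ^ b < 10 ^ q')%N by rewrite ltn_exp2l.
by rewrite yE; nia.
Qed.

(** The fractions [485 / 146] and [1651 / 497] approximate the base 2 logarithm of 10 from below and
    from above. *)
Lemma golay_length_dense :
  exists L : nat, forall x, (L <= x)%N ->
    exists2 l, golay_length l & (l <= x)%N && (512 * (x - l) <= x)%N.
Proof.
have up_lt : (2 ^ 485 < 10 ^ 146)%N by lia.
have up_le : (512 * 10 ^ 146 <= 513 * 2 ^ 485)%N by lia.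
have dn_lt : (10 ^ 497 < 2 ^ 1651)%N by lia.
have dn_le : (512 * 2 ^ 1651 <= 513 * 10 ^ 497)%N by lia.
exists (2 ^ 485 * 10 ^ 497)%N => x x_ge.
exact: (golay_length_exchange up_lt up_le dn_lt dn_le x_ge).
Qed.

(** Each step divides the remainder by at least 512 while it is at least [L]; below [L] the list is
    padded with zeros. *)
Lemma greedy_lengths L :
    (forall x, (L <= x)%N ->
      exists2 l, golay_length l & (l <= x)%N && (512 * (x - l) <= x)%N) ->
  forall r x, exists ls : seq nat,
    [/\ size ls = r, forall l, l \in ls -> golay_length l, (sumn ls <= x)%N
      & (512 ^ r * (x - sumn ls) <= 512 ^ r * L + x)%N].
Proof.
move=> dense; elim=> [|r IHr] x.
  by exists [::]; split=> //=; lia.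
have [Lx|xL] := leqP L x.
  have [l lP /andP[lx lx']] := dense x Lx.
  have [ls [ls_size lsP ls_le ls_close]] := IHr (x - l)%N.
  exists (l :: ls); split; rewrite /= ?ls_size //.
  - by move=> k; rewrite inE => /predU1P[->|/lsP].
  - by lia.
  - by rewrite expnS; nia.
have [ls [ls_size lsP ls_le _]] := IHr x.
exists (0%N :: ls); split; rewrite /= ?ls_size ?add0n //.
- by move=> k; rewrite inE => /predU1P[->|/lsP //]; exact: GolayLength0.
- by nia.
Qed.

Lemma sqrt_floor n : exists q, (q ^ 2 <= n < q.+1 ^ 2)%N.
Proof.
elim: n => [|n [q /andP[q_le q_gt]]]; first by exists 0%N.
have [?|?] := ltnP n.+1 (q.+1 ^ 2)%N; first by exists q; lia.
by exists q.+1; nia.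
Qed.

(** With [r] lengths the sum reaches [2 ^ (9 * r)], and the factor [4 ^ r] brings [N] to the order
    of [2 ^ (11 * r)]. So [n] is of order [2 ^ (22 * r)], while the gap [g] is only of order
    [2 ^ (2 * r)]. *)
Lemma hadamard_orders_dense :
  exists n0 : nat, forall n, (n0 <= n)%N -> exists (ls : seq nat) (g : nat),
    let N := ((1 + 4 * sumn ls) * 4 ^ (size ls).+1)%N in
    [/\ forall l, l \in ls -> golay_length l, (N ^ 2 <= n)%N,
        (n <= (N + g) ^ 2)%N, (0 < g)%N & ((3 * g) ^ 10 <= n)%N].
Proof.
have [L dense] := golay_length_dense.
(* Here [3 * g] will be [c * 4 ^ r.+1], and [r0] makes [r] so large that its tenth power is at most
   [n]. *)
pose c := (12 * (4 * L + 4))%N; pose r0 := (c ^ 10 * 2 ^ 14)%N.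
exists (2 ^ (22 * r0 + 8))%N => n n_ge.
have exr : exists r, (n < 2 ^ (22 * r + 8))%N.
  exists n; apply: (leq_trans (ltn_expl n (isT : 1 < 2)%N)).
  by rewrite leq_exp2l //; lia.
case: (ex_minnP exr) => r n_lt r_min.
have r_gt : (r0 < r)%N.
  rewrite ltnNge; apply/negP => r_le; move: n_lt; rewrite ltnNge => /negP; apply.
  by apply: leq_trans n_ge; rewrite leq_exp2l //; lia.
case: r r_gt n_lt r_min => // r; rewrite ltnS => r_ge n_lt r_min.
have {r_min} n_ge' : (2 ^ (22 * r + 8) <= n)%N.
  by rewrite leqNgt; apply/negP => /r_min; rewrite ltnn.
have [Q /andP[Q_le Q_gt]] := sqrt_floor n.
have Q_lt : (Q < 2 ^ (11 * r.+1 + 4))%N.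
  rewrite -(ltn_exp2r _ _ (isT : 0 < 2)%N) -expnM.
  by apply: (leq_ltn_trans Q_le); rewrite (_ : _ * 2 = 22 * r.+1 + 8)%N //; lia.
have Q_ge : (2 ^ (11 * r + 4) <= Q)%N.
  rewrite -ltnS -(ltn_exp2r _ _ (isT : 0 < 2)%N) -expnM.
  by apply: leq_ltn_trans Q_gt; rewrite (_ : _ * 2 = 22 * r + 8)%N //; lia.
pose B := (4 ^ r.+2)%N.
have B_gt0 : (0 < B)%N by rewrite expn_gt0.
have BE : B = (2 ^ (2 * r.+2))%N by rewrite expnM.
have B_le : (B <= Q)%N.
  by apply: leq_trans Q_ge; rewrite BE leq_exp2l //; lia.
(* The largest [x] with [(1 + 4 * x) * B <= Q]. *)
pose x := ((Q %/ B).-1 %/ 4)%N.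
have QB_gt0 : (0 < Q %/ B)%N by rewrite divn_gt0.
have QB_le : (Q %/ B * B <= Q)%N := leq_trunc_div Q B.
have QB_gt : (Q < (Q %/ B).+1 * B)%N := ltn_ceil Q B_gt0.
have x_le : (1 + 4 * x <= Q %/ B)%N by move: QB_gt0; rewrite /x; clear; lia.
have x_gt : (Q %/ B <= 4 * x + 4)%N by move: QB_gt0; rewrite /x; clear; lia.
have x_lt : (x < 512 ^ r.+1)%N.
  have E : (2 ^ (11 * r.+1 + 4) = 4 * B * 512 ^ r.+1)%N.
    rewrite BE -[512%N]/(2 ^ 9)%N -[4%N]/(2 ^ 2)%N -expnM -!expnD.
    by congr (2 ^ _)%N; lia.
  have B4_gt0 : (0 < 4 * B)%N by rewrite muln_gt0.
  rewrite -(ltn_pmul2l B4_gt0) -E.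
  apply: leq_ltn_trans Q_lt; apply: leq_trans QB_le.
  by rewrite mulnAC leq_mul2r; apply/orP; right; move: x_le; clear; lia.
have [ls [ls_size lsP ls_le ls_close]] := greedy_lengths dense r.+1 x.
have close : (x - sumn ls <= L)%N.
  have pow_gt0 : (0 < 512 ^ r.+1)%N by rewrite expn_gt0.
  rewrite -ltnS -(ltn_pmul2l pow_gt0).
  by apply: (leq_ltn_trans ls_close); rewrite mulnS; lia.
exists ls, (B * (4 * L + 4))%N; rewrite /= ls_size -/B; split=> //.
- apply: leq_trans Q_le; rewrite leq_exp2r //; apply: leq_trans QB_le.
  by rewrite leq_mul2r; apply/orP; right; move: x_le ls_le; clear; lia.
- apply: (leq_trans (ltnW Q_gt)); rewrite leq_exp2r //; apply: (leq_trans QB_gt).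
  rewrite [(B * _)%N]mulnC -mulnDl leq_mul2r; apply/orP; right.
  by move: x_gt close; clear; lia.
- by rewrite muln_gt0 B_gt0 addn_gt0 orbT.
apply: leq_trans n_ge'.
have -> : (3 * (B * (4 * L + 4)) = c * 4 ^ r.+1)%N.
  by rewrite /B /c expnS; ring.
have -> : ((c * 4 ^ r.+1) ^ 10 = c ^ 10 * 2 ^ (20 * r.+1))%N.
  by rewrite expnMn -[4%N]/(2 ^ 2)%N -!expnM; congr (_ * 2 ^ _)%N; lia.
have c_le : (c ^ 10 * 2 ^ 14 <= 2 ^ (2 * r))%N.
  apply: (leq_trans r_ge); apply: ltnW; apply: (leq_trans (ltn_expl r (isT : 1 < 2)%N)).
  by rewrite leq_exp2l //; lia.
have -> : (22 * r + 8 = 2 * r + (20 * r + 8))%N by lia.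
have -> : (2 ^ (20 * r.+1) = 2 ^ 12 * 2 ^ (20 * r + 8))%N.
  by rewrite -expnD; congr (2 ^ _)%N; lia.
rewrite (expnD 2 (2 * r)) mulnA leq_mul2r; apply/orP; right.
by apply: leq_trans c_le; rewrite leq_mul2l leq_exp2l // orbT.
Qed.

End Density.

(** * Comparison with the powers of [n] *)

Theorem theorem1 (R : realType) :
  exists N : nat, forall n : nat, (N <= n)%N ->
    exists G : simple_graph 'I_n,
      n%:R `^ (3 / 2) / 2 - n%:R `^ (11 / 10) <= graph_energy R G.
Proof.
have [n0 dense] := hadamard_orders_dense.
exists n0 => n /dense[ls [g [lsP N2_le n_le g_gt0 g_le]]].
have [T [A [hA cardT]]] := hadamard_lengths R lsP.
rewrite -cardT in N2_le n_le.
have T_gt0 : (0 < #|T|)%N by rewrite cardT muln_gt0 expn_gt0.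
have [G energy_ge] := hadamard_graph hA T_gt0 N2_le.
exists G; apply: le_trans energy_ge.
move: T_gt0 N2_le n_le; set N := #|T| => N_gt0 N2_le n_le.
have n_gt0 : (0 < n)%N by apply: leq_trans N2_le; rewrite expn_gt0 N_gt0.
have n_ge0 : 0 <= n%:R :> R by [].
have s0 := sqrtr_ge0 (n%:R : R); have s2 := sqr_sqrtr n_ge0.
have E32 : n%:R `^ (3 / 2) = n%:R * Num.sqrt n%:R :> R.
  rewrite -[X in _ = X * _]powRr1 // -powR12_sqrt // -powRD; last first.
    by rewrite pnatr_eq0 -lt0n n_gt0 implybT.
  by congr (_ `^ _); field.
have E11 : n%:R * (3 * g%:R) <= n%:R `^ (11 / 10) :> R.
  have -> : n%:R `^ (11 / 10) = n%:R * n%:R `^ (10%:R^-1) :> R.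
    rewrite -[X in _ = X * _]powRr1 // -powRD; last first.
      by rewrite pnatr_eq0 -lt0n n_gt0 implybT.
    by congr (_ `^ _); field.
  rewrite ler_wpM2l //.
  have -> : 3 * g%:R = ((3 * g) ^ 10)%:R `^ (10%:R^-1) :> R.
    rewrite natrX -powR_mulrn // -powRrM divff ?pnatr_eq0 // powRr1 //.
    by rewrite natrM.
  by apply: ge0_ler_powR; rewrite ?nnegrE ?ler_nat // invr_ge0.
rewrite E32; set s := Num.sqrt _ in s0 s2 *.
have N_le : N%:R <= s.
  by rewrite -(ler_pXn2r (isT : 0 < 2)%N) ?nnegrE // s2 -natrX ler_nat.
have s_le : s <= N%:R + g%:R.
  by rewrite -(ler_pXn2r (isT : 0 < 2)%N) ?nnegrE ?addr_ge0 // s2 -natrD -natrX ler_nat.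
have g_ge1 : 1 <= g%:R :> R by rewrite ler1n.
have N_ge1 : 1 <= N%:R :> R by rewrite ler1n.
move: E11; rewrite -s2; set y := _ `^ _; move: (N%:R) (g%:R) y N_le s_le g_ge1 N_ge1.
move=> m d y m_le s_le d1 m1 E11.
(* Of [3 * d * s ^+ 2 <= y], one half covers the difference of the halved cubes, the other half
   covers [m ^+ 2 / 2 + m]. *)
have cube : s ^+ 3 - m ^+ 3 <= 3 * d * s ^+ 2.
  have -> : s ^+ 3 - m ^+ 3 = (s - m) * (s ^+ 2 + s * m + m ^+ 2) by ring.
  have -> : 3 * d * s ^+ 2 = d * (3 * s ^+ 2) by ring.
  by apply: ler_pM; nra.
have m2_le : m ^+ 2 <= s ^+ 2 by nra.
have m_le2 : m <= m ^+ 2 by nra.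
have ds : s ^+ 2 <= d * s ^+ 2 by nra.
nra.
Qed.
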